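(* Let $A = x^a(x+1)^b(x+\alpha)^c(x+\alpha+1)^d \in \mathbb{F}_4[x]$, where $a,b,c,d\in\mathbb{N}$ are not all odd. Then $A$ is indecomposable bi-unitary perfect over $\mathbb{F}_4$ if and only if $(a,b,c,d)$ is one of the following twelve quadruples: $$(4,4,3,5),\ (4,4,5,3),\ (6,6,3,5),\ (6,6,5,3),\ (4,3,4,3),\ (4,5,4,5),\ (4,3,3,4),\ (4,5,5,4),\ (4,4,4,4),\ (4,4,6,6),\ (6,6,4,4),\ (6,6,6,6).$$
   Context: $\mathbb{N}$ is the set of non-negative integers. $\mathbb{F}_4=\{0,1,\alpha,\alpha+1\}$ is the field with 4 elements, where $\alpha^2+\alpha+1=0$. Divisors of polynomials are taken monic. For a nonzero (monic) polynomial $S$ over a finite field, a divisor $D$ of $S$ is unitary if $\gcd(D,S/D)=1$; $\gcd_u(S,T)$ denotes the greatest common unitary divisor of $S$ and $T$; a divisor $D$ of $S$ is bi-unitary if $\gcd_u(D,S/D)=1$. $\sigma^{**}(S)$ is the sum of all bi-unitary divisors of $S$, and $S$ is bi-unitary perfect if $\sigma^{**}(S)=S$. A polynomial $A$ is trivially bi-unitary perfect if it is bi-unitary perfect and can be written as a product $A=A_0\cdots A_r$ with $r\ge 1$, where each $A_i$ is (nonconstant and) bi-unitary perfect over the same field and $\gcd(A_i,A_j)=1$ for $i\ne j$. $A$ is indecomposable bi-unitary perfect if it is bi-unitary perfect but not trivially bi-unitary perfect.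
   Formalization: The exponents a,b,c,d are taken positive, since x(x+1) is an unlisted counterexample, and ''is one of'' is read up to the translations x→x+t with t in F_4, since (3,4,3,4), a translate of (4,3,4,3), is also indecomposable bi-unitary perfect. *)

(* Defs.v *)
From mathcomp Require Export all_boot all_order all_algebra.
From mathcomp Require Export qpoly.

Set Implicit Arguments.
Unset Strict Implicit.
Unset Printing Implicit Defensive.

Import GRing.Theory.
Local Open Scope ring_scope.

Definition unitary_divisor (F : finFieldType) (D S : {poly F}) : bool :=
  [&& D \is monic, D %| S & coprimep D (S %/ D)].

(* The divisors of a nonzero S have size at most size S, so they all lie in the
   finite type {poly_(size S) F}; for S != 0 the element npolyp (size S) 1 is
   the constant 1, a common unitary divisor.  "Greatest" means of greatest
   degree. *)
Definition gcdu (F : finFieldType) (S T : {poly F}) : {poly F} :=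
  [arg max_(D > npolyp (size S) 1
     | unitary_divisor (D : {poly F}) S && unitary_divisor (D : {poly F}) T)
     size (D : {poly F})].

Definition biunitary_divisor (F : finFieldType) (D S : {poly F}) : bool :=
  [&& D \is monic, D %| S & gcdu D (S %/ D) == 1].

Definition sigma_bu (F : finFieldType) (S : {poly F}) : {poly F} :=
  \sum_(D : {poly_(size S) F} | biunitary_divisor (D : {poly F}) S)
    (D : {poly F}).

(* Monicity only excludes S = 0, for which the sum is empty: the sum is monic
   for every nonzero S. *)
Definition biunitary_perfect (F : finFieldType) (S : {poly F}) : bool :=
  (S \is monic) && (sigma_bu S == S).

Definition trivially_biunitary_perfect (F : finFieldType) (S : {poly F}) :
    Prop :=
  biunitary_perfect S /\
  exists (r : nat) (A_ : 'I_r.+1 -> {poly F}),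
    [/\ (1 <= r)%N,
        S = \prod_(i < r.+1) A_ i,
        forall i, (1 < size (A_ i))%N && biunitary_perfect (A_ i)
      & forall i j, i != j -> coprimep (A_ i) (A_ j)].

Definition indecomposable_biunitary_perfect (F : finFieldType) (S : {poly F}) :
    Prop :=
  biunitary_perfect S /\ ~ trivially_biunitary_perfect S.

(* Since 0, 1, alpha, alpha + 1 are all the elements of F, a translation
   x |-> x + t, which preserves (indecomposable) bi-unitary perfection, acts on
   the exponents of x^a (x+1)^b (x+alpha)^c (x+alpha+1)^d by one of these four
   permutations (t = 0, 1, alpha, alpha + 1 respectively). *)
Definition translates (a b c d : nat) : seq (nat * nat * nat * nat) :=
  [:: (a, b, c, d); (b, a, d, c); (c, d, a, b); (d, c, b, a)].

(* Main.v *)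
Require Import Defs.
From mathcomp Require Import finfield zify ring.

(* A polynomial with all its roots in F is prod_r (X - r)^(e r), and its
   bi-unitary divisors are the prod_r (X - r)^(k r) with k r <= e r and
   2 (k r) <> e r unless e r = 0; so sigma** is the product over r of
   T_n(Y) = 1 + Y + ... + Y^n, without Y^(n/2) when n > 0 is even, taken at
   n = e r and Y = X - r.  If the product is perfect then every T_(e r)(X - r)
   splits over F_4.  Now (Y + 1) T_n is Y^(n+1) + 1 for odd n and
   (Y^(m+1) + 1) (Y^m + 1) for n = 2m > 0.  For odd u, Y^u + 1 is separable, so it
   can only split over F_4 if u is 1 or 3; hence an even n > 0 is 2, 4 or 6, an
   odd n is 2^i - 1 or 3 * 2^i - 1, and T_n(Y) = (Y + 1)^E (Y^2 + Y + 1)^G.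
   Here Y^2 + Y + 1 = (Y + alpha) (Y + alpha + 1), so that perfection amounts
   to four linear equations between the exponents.  If all the G vanish, the
   polynomial is the product of two perfect ones, with roots {0, 1} and
   {alpha, alpha + 1}.  Otherwise, some exponent being even, all exponents
   are at most 23, which leaves finitely many cases; and a perfect coprime
   factor having a root r with G > 0 has all of F_4 as roots, so that the
   polynomial is indecomposable. *)

Import GRing.Theory.
Local Open Scope ring_scope.
Set Implicit Arguments.
Unset Strict Implicit.
Unset Printing Implicit Defensive.

(** * Split polynomials and their bi-unitary divisors *)

Section LinProd.
Variable F : finFieldType.
Implicit Types (e k : F -> nat) (D S T U : {poly F}) (r : F).

Definition lin_prod e : {poly F} := \prod_r ('X - r%:P) ^+ e r.

Lemma lin_prod_monic e : lin_prod e \is monic.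
Proof. by apply: monic_prod => r _; rewrite monic_exp ?monicXsubC. Qed.

Lemma lin_prod_neq0 e : lin_prod e != 0.
Proof. exact/monic_neq0/lin_prod_monic. Qed.

Lemma eq_lin_prod e k : e =1 k -> lin_prod e = lin_prod k.
Proof. by move=> ek; apply: eq_bigr => r _; rewrite ek. Qed.

Lemma lin_prodD e k : lin_prod (fun r => e r + k r)%N = lin_prod e * lin_prod k.
Proof. by rewrite -big_split; apply: eq_bigr => r _; rewrite exprD. Qed.

Lemma lin_prod_delta r n :
  lin_prod (fun s => if s == r then n else 0%N) = ('X - r%:P) ^+ n.
Proof.
rewrite /lin_prod (bigD1 r) //= eqxx big1 ?mulr1 // => s /negbTE ->.
by rewrite expr0.
Qed.

Lemma coprimep_lin_prod e D :
  (forall r, (0 < e r)%N -> ~~ root D r) -> coprimep D (lin_prod e).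
Proof.
move=> noroot; apply: (big_ind (coprimep D)) => [|S T DS DT|r _].
- exact: coprimep1.
- by rewrite coprimepMr DS.
have [->|er] := posnP (e r); first by rewrite expr0 coprimep1.
by rewrite coprimep_expr // coprimep_XsubC noroot.
Qed.

Lemma mup_lin_prod e r : mup r (lin_prod e) = e r.
Proof.
rewrite /lin_prod (bigD1 r) //= mupMl ?mup_XsubCX ?eqxx //.
apply: (big_ind (fun S => ~~ root S r)) => [|S T|s /negbTE sr].
- by rewrite root1.
- by rewrite rootM negb_or => -> ->.
by rewrite /root horner_exp hornerXsubC expf_neq0 // subr_eq0 eq_sym sr.
Qed.

(** Induction on the size of [D], splitting off a root. Without roots, [D] is coprime to
    [lin_prod e], which it divides, so it is 1. *)
Lemma dvdp_lin_prod e D : D \is monic -> D %| lin_prod e ->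
  D = lin_prod (fun r => mup r D).
Proof.
have [n] := ubnP (size D); elim: n D => // n IHn D sDn Dm DS.
have D0 := monic_neq0 Dm.
have [r rD|noroot] := pickP (root D).
  have /dvdpP[D' Dd] : 'X - r%:P %| D by rewrite dvdp_XsubCl.
  have D'm : D' \is monic by move: Dm; rewrite Dd monicMr ?monicXsubC.
  have D'0 := monic_neq0 D'm.
  rewrite [LHS]Dd (IHn D') //; first last.
  - by apply: dvdp_trans DS; rewrite Dd dvdp_mulr.
  - by move: sDn; rewrite Dd size_Mmonic ?monicXsubC // size_XsubC addn2.
  rewrite -[X in _ * X]expr1 -lin_prod_delta -lin_prodD.
  apply: eq_lin_prod => s; rewrite Dd mupM ?polyXsubC_eq0 //.
  by rewrite -['X - _ in RHS]expr1 mup_XsubCX eq_sym.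
have D1 : D = 1.
  apply/eqP; rewrite -eqp_monic ?monic1 // -size_poly_eq1.
  rewrite -coprimepp (coprimep_dvdl DS) // coprimep_lin_prod // => r _.
  by rewrite noroot.
rewrite {1}D1 /lin_prod big1 // => r _; rewrite mupNroot ?expr0 //.
by rewrite noroot.
Qed.

Lemma dvdp_leq_mup D S r : S != 0 -> D %| S -> (mup r D <= mup r S)%N.
Proof.
move=> S0 DS; have D0 := dvdpN0 DS S0.
by rewrite mup_geq // (dvdp_trans _ DS) // -mup_geq.
Qed.

Lemma lin_prod_dvd e k :
  (lin_prod k %| lin_prod e) = [forall r, (k r <= e r)%N].
Proof.
apply/idP/forallP => [ke r|ke].
  by rewrite -(mup_lin_prod k) -(mup_lin_prod e) dvdp_leq_mup ?lin_prod_neq0.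
rewrite (@eq_lin_prod e (fun r => k r + (e r - k r))%N) ?lin_prodD ?dvdp_mulr //.
by move=> r; rewrite subnKC.
Qed.

(** The cofactor of [U] is coprime to [U], so it does not vanish at [r]. *)
Lemma unitary_divisor_mup U D r :
  D != 0 -> unitary_divisor U D -> root U r -> mup r U = mup r D.
Proof.
move=> D0 /and3P[_ UD cop] Ur.
rewrite -[in RHS](divpK UD) mupMr //.
by apply: contraTN Ur => /(coprimep_root _) Ur; apply: Ur; rewrite coprimep_sym.
Qed.

Lemma unitary_divisor_XsubC D r :
  D != 0 -> unitary_divisor (('X - r%:P) ^+ mup r D) D.
Proof.
move=> D0; have dvd : ('X - r%:P) ^+ mup r D %| D by rewrite -mup_geq.
rewrite /unitary_divisor monic_exp ?monicXsubC // dvd.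
rewrite coprimep_sym coprimep_expr // coprimep_XsubC.
apply/negP => rQ; have : (('X - r%:P) ^+ (mup r D).+1 %| D).
  by rewrite exprS -[X in _ %| X](divpK dvd) dvdp_mul // dvdp_XsubCl.
by rewrite -mup_geq // ltnn.
Qed.

(** [gcdu] has the greatest size, so if it is 1, every common unitary divisor is a monic
    constant. *)
Lemma gcdu_eq1P D T : D != 0 ->
  reflect (forall U, unitary_divisor U D -> unitary_divisor U T -> U = 1)
          (gcdu D T == 1).
Proof.
move=> D0; rewrite /gcdu.
have u1 S : unitary_divisor 1 S by rewrite /unitary_divisor monic1 dvd1p coprime1p.
case: arg_maxnP => [|U /andP[UD UT] Umax].
  by rewrite npolypK ?u1 // size_poly1 size_poly_gt0.
apply: (iffP eqP) => [U1 V VD VT|]; last exact.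
have sV : (size V <= size D)%N by case/and3P: VD => _ /dvdp_leq-> .
have /= := Umax (npolyp (size D) V); rewrite npolypK // VD VT => /(_ isT).
rewrite U1 size_poly1; case/and3P: VD => Vm _ _ Vle.
apply/eqP; rewrite -eqp_monic ?monic1 // -size_poly_eq1 eqn_leq Vle.
by rewrite size_poly_gt0 monic_neq0.
Qed.

(** A unitary divisor contains each of its roots with full multiplicity. Hence [lin_prod k] and its
    cofactor share a nontrivial one iff [k r] and [e r - k r] agree and are positive for some
    [r]. *)
Lemma biunitary_lin_prod e k :
  biunitary_divisor (lin_prod k) (lin_prod e) =
  [forall r, (k r <= e r)%N && ((e r == 0%N) || ((k r).*2 != e r))].
Proof.
rewrite /biunitary_divisor lin_prod_monic lin_prod_dvd /=.
have [/forallP ke|] := boolP [forall r, (k r <= e r)%N]; last first.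
  by case/forallPn => r ker; apply/esym/forallPn; exists r; rewrite negb_and ker.
have -> : lin_prod e %/ lin_prod k = lin_prod (fun r => e r - k r)%N.
  rewrite (@eq_lin_prod e (fun r => (e r - k r) + k r)%N) => [|r].
    by rewrite lin_prodD mulpK ?lin_prod_neq0.
  by rewrite subnK.
apply/(gcdu_eq1P _ (lin_prod_neq0 _))/forallP => [coU r|cok U Uk Uek].
  rewrite ke /=; have [//|er] := posnP; apply/eqP => ker.
  have ekr : (e r - k r)%N = k r by rewrite -ker -addnn addnK.
  have := coU (('X - r%:P) ^+ k r).
  rewrite -{1}(mup_lin_prod k) unitary_divisor_XsubC ?lin_prod_neq0 //.
  rewrite -{1}ekr -(mup_lin_prod (fun r => e r - k r)%N).
  rewrite unitary_divisor_XsubC ?lin_prod_neq0 // => /(_ isT isT).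
  move/(congr1 (fun p : {poly F} => size p)).
  by rewrite size_poly1 size_exp_XsubC; lia.
case/and3P: (Uk) => Um UD _; rewrite (dvdp_lin_prod Um UD) /lin_prod big1 // => r _.
have [Ur|/mupNroot->] := boolP (root U r); last by rewrite expr0.
have := unitary_divisor_mup (lin_prod_neq0 _) Uk Ur.
have := unitary_divisor_mup (lin_prod_neq0 _) Uek Ur.
rewrite !mup_lin_prod => -> ekr; have := ke r; have := cok r.
by have [->|] := posnP (e r - k r); [rewrite expr0 | lia].
Qed.

(** For Y = X - r this is sigma** of the prime power Y^n. The test [n == 0] keeps the only term Y^0
    when n = 0, where [k.*2 = n]. *)
Definition bu_sum (R : nzSemiRingType) (n : nat) (Y : R) : R :=
  \sum_(k < n.+1 | (n == 0%N) || (k.*2 != n)) Y ^+ k.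

(** Expanding the product of sums gives one term for each choice of an admissible exponent at every
    root; [h] and [h'] match these choices with the bi-unitary divisors. *)
Lemma sigma_bu_lin_prod e :
  sigma_bu (lin_prod e) = \prod_r bu_sum (e r) ('X - r%:P).
Proof.
(* A common bound on the exponents puts all choices into one finite function type. *)
pose N := \max_r e r.
pose Q r (k : 'I_N.+1) := (k <= e r)%N && ((e r == 0%N) || (k.*2 != e r)).
transitivity (\prod_r \sum_(k | Q r k) ('X - r%:P) ^+ k); last first.
  apply: eq_bigr => r _; rewrite /bu_sum.
  rewrite (big_ord_widen_cond N.+1 (fun j => (e r == 0%N) || (j.*2 != e r))
             (fun j => ('X - r%:P) ^+ j)); last by rewrite ltnS leq_bigmax.
  by apply: eq_bigl => k; rewrite andbC ltnS.
rewrite bigA_distr_big_dep /sigma_bu.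
set S := lin_prod e.
pose h (f : {ffun F -> 'I_N.+1}) : {poly_(size S) F} :=
  npolyp (size S) (lin_prod (fun r => f r)).
pose h' (D : {poly_(size S) F}) : {ffun F -> 'I_N.+1} :=
  [ffun r => inord (mup r (D : {poly F}))].
have leN r m : (m <= e r)%N -> (m < N.+1)%N.
  by move=> me; rewrite ltnS (leq_trans me) // leq_bigmax.
have h'E (D : {poly_(size S) F}) : (D : {poly F}) %| S ->
    forall r, h' D r = mup r (D : {poly F}) :> nat.
  move=> DS r; rewrite ffunE inordK // (leN r) //.
  by rewrite -(mup_lin_prod e) dvdp_leq_mup ?lin_prod_neq0.
have hE (D : {poly_(size S) F}) : biunitary_divisor (D : {poly F}) S ->
    lin_prod (fun r => h' D r) = D.
  case/and3P => Dm DS _; rewrite [RHS](dvdp_lin_prod Dm DS).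
  exact/eq_lin_prod/h'E.
rewrite (reindex_onto h h') => [|D DS]; last first.
  by apply: val_inj; rewrite /= -[RHS]hE // npolypK // hE // size_npoly.
have hfam (f : {ffun F -> 'I_N.+1}) :
    f \in family Q = biunitary_divisor (lin_prod (fun r => f r)) S.
  rewrite biunitary_lin_prod; apply/familyP/forallP => fQ r; exact: fQ.
have sz (f : {ffun F -> 'I_N.+1}) :
    f \in family Q -> h f = lin_prod (fun r => f r) :> {poly F}.
  rewrite hfam => /and3P[_ fS _]; rewrite npolypK // dvdp_leq //.
  exact: lin_prod_neq0.
apply: eq_big => [f|f /andP[biu /eqP hf]]; last by rewrite -hE // hf.
apply/andP/idP => [[biu /eqP hf]|fQ].
  by rewrite hfam -{1}hf hE.
rewrite sz // -hfam fQ; split=> //; apply/eqP/ffunP => r; apply: val_inj.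
rewrite /= h'E ?sz ?mup_lin_prod //.
by move: fQ; rewrite hfam => /and3P[].
Qed.

Lemma biunitary_perfect_lin_prod e :
  biunitary_perfect (lin_prod e) =
  (\prod_r bu_sum (e r) ('X - r%:P) == lin_prod e).
Proof. by rewrite /biunitary_perfect lin_prod_monic sigma_bu_lin_prod. Qed.

Lemma bu_sum_dvd_perfect e r :
  biunitary_perfect (lin_prod e) -> bu_sum (e r) ('X - r%:P) %| lin_prod e.
Proof.
rewrite biunitary_perfect_lin_prod => /eqP <-.
by rewrite (bigD1 r) //= dvdp_mulr.
Qed.

End LinProd.

(* [bu_sum n Y = (Y + 1) ^+ e * (Y ^+ 2 + Y + 1) ^+ f] in characteristic 2 for
   exactly these triples [(n, e, f)]. *)
Definition bu_exps (n e f : nat) : Prop :=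
  [\/ (n, e, f) \in [:: (0, 0, 0); (2, 2, 0); (4, 2, 1); (6, 4, 1)]%N,
      exists i, [/\ n.+1 = 2 ^ i.+1, e = n & f = 0]%N
    | exists i, [/\ n.+1 = 3 * 2 ^ i.+1, e.+1 = 2 ^ i.+1 & f = 2 ^ i.+1]%N].

(** * Closed forms of [bu_sum] and its factorization in characteristic 2 *)

Section BuSum.
Variable R : comNzRingType.
Implicit Types Y : R.

Lemma bu_sum_odd n Y : odd n -> (Y - 1) * bu_sum n Y = Y ^+ n.+1 - 1.
Proof.
move=> n_odd; rewrite subrX1; congr (_ * _); apply: eq_bigl => k.
by case: eqP => // kn; case: eqP => // kn'; move: n_odd; rewrite -kn' odd_double.
Qed.

(** Removing Y^m from the geometric sum leaves Y^(2m+1) - 1 - (Y - 1) Y^m after multiplication by Y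
    - 1. *)
Lemma bu_sum_even m Y : (0 < m)%N ->
  (Y - 1) * bu_sum m.*2 Y = (Y ^+ m.+1 + 1) * (Y ^+ m - 1).
Proof.
move=> m_gt0; have m_lt : (m < m.*2.+1)%N by lia.
have -> : bu_sum m.*2 Y = \sum_(k < m.*2.+1 | k != Ordinal m_lt) Y ^+ k.
  by apply: eq_bigl => k; rewrite -(inj_eq val_inj) /=; lia.
have := subrX1 Y m.*2.+1; rewrite (bigD1 (Ordinal m_lt)) //= mulrDr.
move=> sumE; rewrite -[LHS](addKr ((Y - 1) * Y ^+ m)) -sumE.
by rewrite -addnn -addSn exprD !exprS; ring.
Qed.

Lemma bu_sum0 Y : bu_sum 0 Y = 1.
Proof. by rewrite /bu_sum big_ord_recl big_ord0 addr0. Qed.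

End BuSum.

Lemma exprD1_pow2 (R : comNzRingType) (Y : R) i :
  2%N \in [pchar R] -> (Y + 1) ^+ (2 ^ i) = Y ^+ (2 ^ i) + 1.
Proof.
by move=> R2; rewrite exprDn_pchar ?expr1n // (eq_pnat _ (pcharf_eq R2)) pnatX.
Qed.

(** For n > 0, multiplying by Y + 1 gives the closed forms above; these factor by Y^3 + 1 = (Y + 1)
    (Y^2 + Y + 1) and the additivity of 2^i-th powers. *)
Lemma bu_sum_exps (R : idomainType) (Y : R) n e f :
  2%N \in [pchar R] -> Y + 1 != 0 -> bu_exps n e f ->
  bu_sum n Y = (Y + 1) ^+ e * (Y ^+ 2 + Y + 1) ^+ f.
Proof.
move=> R2 Y1; have sub1 (x : R) : x - 1 = x + 1 by rewrite (oppr_pchar2 R2).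
have cube (x : R) : x ^+ 3 + 1 = (x + 1) * (x ^+ 2 + x + 1).
  by rewrite -[x + 1]sub1 -[x ^+ 3 + 1]sub1; ring.
case=> [|[i [ni -> ->]]|[i [ni ei ->]]].
- rewrite !inE => /or4P[]/eqP[-> -> ->]; first by rewrite bu_sum0 !expr0 mulr1.
  + apply: (mulfI Y1); rewrite -{1}sub1 (@bu_sum_even _ 1) // sub1.
    by rewrite -(exprD1_pow2 Y 1) //; ring.
  + apply: (mulfI Y1); rewrite -{1}sub1 (@bu_sum_even _ 2) // sub1 cube.
    by rewrite -(exprD1_pow2 Y 1) //; ring.
  + apply: (mulfI Y1); rewrite -{1}sub1 (@bu_sum_even _ 3) // sub1 cube.
    by rewrite -(exprD1_pow2 Y 2) //; ring.
- apply: (mulfI Y1); rewrite -{1}sub1 bu_sum_odd.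
  2: by move: ni; rewrite expnS; lia.
  by rewrite sub1 ni -exprD1_pow2 // -ni expr0 mulr1 exprS.
- apply: (mulfI Y1); rewrite -{1}sub1 bu_sum_odd.
  2: by move: ni; rewrite expnS; lia.
  by rewrite sub1 ni exprM -exprD1_pow2 // cube exprMn mulrA -exprS ei.
Qed.

(** * The equations between the exponents and their solutions *)

Lemma bu_exps_degree n e f : bu_exps n e f -> n = (e + f.*2)%N.
Proof.
case=> [|[i [? -> ->]]|[i [? ? ->]]]; [|lia|lia].
by rewrite !inE => /or4P[]/eqP[] *; subst.
Qed.

Lemma bu_exps_even n e f : bu_exps n e f -> ~~ odd n -> (n <= 6)%N && (e <= 4)%N.
Proof.
case=> [|[i [ni _ _]]|[i [ni _ _]]].
- by rewrite !inE => /or4P[]/eqP[] *; subst.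
- by move: ni; rewrite expnS; lia.
- by move: ni; rewrite expnS; lia.
Qed.

Lemma bu_exps_leq n e f : bu_exps n e f -> (0 < f)%N -> (e <= f + 3)%N.
Proof.
case=> [|[i [_ _ ->]]|[i [_ ei ->]]] //; last by lia.
by rewrite !inE => /or4P[]/eqP[] *; subst.
Qed.

Definition small_bu_exps : seq (nat * nat * nat) :=
  [:: (1, 1, 0); (2, 2, 0); (3, 3, 0); (4, 2, 1); (5, 1, 2); (6, 4, 1);
      (7, 7, 0); (11, 3, 4); (15, 15, 0); (23, 7, 8)]%N.

Lemma bu_exps_small n e f :
  bu_exps n e f -> (0 < n < 24)%N -> (n, e, f) \in small_bu_exps.
Proof.
case=> [|[i [ni -> ->]]|[i [ni ei ->]]].
- by rewrite !inE => /or4P[]/eqP[-> -> ->].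
- case: i ni => [|[|[|[|i]]]] ni; try by rewrite (succn_inj ni).
  by move: ni; rewrite !expnS; lia.
- case: i ni ei => [|[|[|i]]] ni ei; try by rewrite -[n]/n.+1.-1 ni -[e]/e.+1.-1 ei.
  by move: ni; rewrite !expnS; lia.
Qed.

(** An even [a] is at most 6, which bounds [fc + fd], [b], [fa] and [fb]. If [fc] or [fd] is
    positive, [bu_exps_leq] then bounds [c] and [d]. If both vanish, then [c = ec] and [d = ed], and
    the last two equations force [fa + fb = 0], a contradiction. *)
Lemma bu_exps_bounded a b c d ea fa eb fb ec fc ed fd :
  bu_exps a ea fa -> bu_exps b eb fb -> bu_exps c ec fc -> bu_exps d ed fd ->
  a = (eb + fc + fd)%N -> b = (ea + fc + fd)%N ->
  c = (ed + fa + fb)%N -> d = (ec + fa + fb)%N ->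
  ~~ odd a -> (0 < fa + fb + fc + fd)%N ->
  [&& a < 24, b < 24, c < 24 & d < 24]%N.
Proof.
move=> Ha Hb Hc Hd eqa eqb eqc eqd a_even.
have /andP[a6 ea4] := bu_exps_even Ha a_even.
move: (bu_exps_degree Ha) (bu_exps_degree Hb).
move: (bu_exps_degree Hc) (bu_exps_degree Hd).
move: (bu_exps_leq Hc) (bu_exps_leq Hd).
case: (posnP fc) => [->|fc_gt0]; case: (posnP fd) => [->|fd_gt0] lc ld; lia.
Qed.

Definition solutions : seq (nat * nat * nat * nat) :=
  [:: (4, 4, 3, 5); (4, 4, 5, 3); (6, 6, 3, 5); (6, 6, 5, 3);
      (4, 3, 4, 3); (4, 5, 4, 5); (4, 3, 3, 4); (4, 5, 5, 4);
      (4, 4, 4, 4); (4, 4, 6, 6); (6, 6, 4, 4); (6, 6, 6, 6)]%N.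

(** Translations permute the four equations, so whichever exponent is even can take the place of [a]
    in [bu_exps_bounded]. *)
Lemma bu_exps_system a b c d ea fa eb fb ec fc ed fd :
  [&& (0 < a)%N, (0 < b)%N, (0 < c)%N & (0 < d)%N] ->
  ~~ [&& odd a, odd b, odd c & odd d] ->
  bu_exps a ea fa -> bu_exps b eb fb -> bu_exps c ec fc -> bu_exps d ed fd ->
  a = (eb + fc + fd)%N -> b = (ea + fc + fd)%N ->
  c = (ed + fa + fb)%N -> d = (ec + fa + fb)%N ->
  (0 < fa + fb + fc + fd)%N ->
  has (fun q => q \in solutions) (translates a b c d).
Proof.
move=> pos nodd Ha Hb Hc Hd eqa eqb eqc eqd f_gt0.
have /and4P[a24 b24 c24 d24] : [&& a < 24, b < 24, c < 24 & d < 24]%N.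
  move: nodd; rewrite !negb_and => /or4P[] even1.
  - by apply: (bu_exps_bounded Ha Hb Hc Hd).
  - have := bu_exps_bounded Hb Ha Hd Hc _ _ _ _ even1; lia.
  - have := bu_exps_bounded Hc Hd Ha Hb _ _ _ _ even1; lia.
  - have := bu_exps_bounded Hd Hc Hb Ha _ _ _ _ even1; lia.
case/and4P: pos => a0 b0 c0 d0.
pose check (p q r s : nat * nat * nat) :=
  let: (a, ea, fa) := p in let: (b, eb, fb) := q in
  let: (c, ec, fc) := r in let: (d, ed, fd) := s in
  [&& ~~ [&& odd a, odd b, odd c & odd d],
      a == (eb + fc + fd)%N, b == (ea + fc + fd)%N,
      c == (ed + fa + fb)%N, d == (ec + fa + fb)%N & (0 < fa + fb + fc + fd)%N] ==>
  has (fun q => q \in solutions) (translates a b c d).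
(* The 10^4 remaining combinations are checked by computation. *)
have /allP chk : all (fun p => all (fun q => all (fun r => all (check p q r)
    small_bu_exps) small_bu_exps) small_bu_exps) small_bu_exps by vm_compute.
have n24 n : (0 < n)%N -> (n < 24)%N -> (0 < n < 24)%N by move=> -> ->.
have /allP chk2 := chk _ (bu_exps_small Ha (n24 _ a0 a24)).
have /allP chk3 := chk2 _ (bu_exps_small Hb (n24 _ b0 b24)).
have /allP chk4 := chk3 _ (bu_exps_small Hc (n24 _ c0 c24)).
have /implyP := chk4 _ (bu_exps_small Hd (n24 _ d0 d24)); apply.
by rewrite nodd f_gt0 -eqa -eqb -eqc -eqd !eqxx.
Qed.

(** The exponents in [solutions] are at most 6; beyond that the default value is meaningless. *)
Definition exps_of (n : nat) : nat * nat :=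
  nth (0, 0)%N [:: (0, 0); (1, 0); (2, 0); (3, 0); (2, 1); (1, 2); (4, 1)]%N n.

Lemma exps_ofP n : (n < 7)%N -> bu_exps n (exps_of n).1 (exps_of n).2.
Proof.
case: n => [|[|[|[|[|[|[|//]]]]]]] _; do ?by constructor 1.
- by constructor 2; exists 0%N.
- by constructor 2; exists 1%N.
- by constructor 3; exists 0%N.
Qed.

Lemma solutions_system a b c d :
  has (fun q => q \in solutions) (translates a b c d) ->
  let E n := (exps_of n).1 in let G n := (exps_of n).2 in
  [&& all (fun n => 2 < n < 7)%N [:: a; b; c; d],
      has (fun n => 0 < G n)%N [:: a; b; c; d],
      a == (E b + G c + G d)%N, b == (E a + G c + G d)%N,
      c == (E d + G a + G b)%N & d == (E c + G a + G b)%N].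
Proof.
move=> sol; pose check q := let: (a, b, c, d) := q in
  let E n := (exps_of n).1 in let G n := (exps_of n).2 in
  [&& all (fun n => 2 < n < 7)%N [:: a; b; c; d],
      has (fun n => 0 < G n)%N [:: a; b; c; d],
      a == (E b + G c + G d)%N, b == (E a + G c + G d)%N,
      c == (E d + G a + G b)%N & d == (E c + G a + G b)%N].
have /allP chk : all (fun q => let: (a, b, c, d) := q in
    all check (translates a b c d)) solutions by vm_compute.
suff: check (a, b, c, d) by [].
(* Each translation is an involution, so the given quadruple is itself a translate of the listed
   one. *)
case/or4P: sol => [|||/orP[]//] /chk /allP; apply; rewrite !inE eqxx ?orbT //.
Qed.

(** * Splitting over the field with four elements *)

Section F4.
Variables (F : finFieldType) (alpha : F).
Hypotheses (hF : #|F| = 4%N) (halpha : alpha ^+ 2 + alpha + 1 = 0).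
Implicit Types (e : F -> nat) (r s t : F).

(** Every element is its own fourth power, so -1 = (-1)^4 = 1. *)
Lemma F4_pchar2 : 2%N \in [pchar F].
Proof.
rewrite inE /=; have := expf_card (-1 : F); rewrite hF -signr_odd expr0 => /eqP.
by rewrite -addr_eq0 mulr2n.
Qed.

Lemma polyF4_pchar2 : 2%N \in [pchar {poly F}].
Proof. by rewrite pchar_poly F4_pchar2. Qed.

Lemma XsubC_add1 r : 'X - r%:P + 1 = 'X - (r + 1)%:P.
Proof. by rewrite polyCD opprD addrA [- 1](oppr_pchar2 polyF4_pchar2). Qed.

Lemma F4_uniq : uniq [:: 0; 1; alpha; alpha + 1].
Proof.
have a0 : alpha != 0.
  by apply: contra_eq_neq halpha => ->; rewrite expr0n !add0r oner_neq0.
have a1 : alpha != 1.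
  apply: contra_eq_neq halpha => ->; rewrite expr1n.
  by rewrite (addrr_pchar2 F4_pchar2) add0r oner_neq0.
rewrite /= !inE !negb_or !(eq_sym 0) oner_neq0 a0 (eq_sym 1 alpha) a1 /=.
rewrite addr_eq0 (oppr_pchar2 F4_pchar2) a1 /=.
rewrite -{1}[1]add0r (inj_eq (addIr 1)) eq_sym a0 /=.
by rewrite -{1}[alpha]addr0 (inj_eq (addrI alpha)) eq_sym oner_neq0.
Qed.

Lemma F4_enum : perm_eq (index_enum F) [:: 0; 1; alpha; alpha + 1].
Proof.
rewrite perm_sym; apply: uniq_perm; first exact: F4_uniq.
  exact: index_enum_uniq.
have [||_ eqE] := @uniq_min_size _ _ (index_enum F) F4_uniq.
- by move=> x _; rewrite mem_index_enum.
- by rewrite -[index_enum F]enumT -cardE hF.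
exact: eqE.
Qed.

Lemma F4_cases s : s \in [:: 0; 1; alpha; alpha + 1].
Proof. by rewrite -(perm_mem F4_enum) mem_index_enum. Qed.

(** Put Y = X - r. In characteristic 2 with odd [u], D = Y D' + 1, so D and its derivative have no
    common zero. Hence D divides the product of the four X - t, and [u] is at most 4. *)
Lemma XsubCX_add1_split e r u : odd u ->
  ('X - r%:P) ^+ u + 1 %| lin_prod e -> (u == 1%N) || (u == 3%N).
Proof.
move=> u_odd; set D := _ + 1 => DS.
have sD : size D = u.+1.
  rewrite size_polyDl size_exp_XsubC // size_poly1; lia.
have Dm : D \is monic.
  rewrite monicE lead_coefDl ?size_exp_XsubC ?size_poly1; last by lia.
  by rewrite -monicE monic_exp ?monicXsubC.
have D0 := monic_neq0 Dm.
have mup1 t : (mup t D <= 1)%N.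
  rewrite mup_leq //; apply/negP => /dvdpP[Q DQ].
  have Dt : D.[t] = 0.
    by rewrite DQ hornerM horner_exp hornerXsubC subrr expr0n mulr0.
  have D't : D^`().[t] = 0.
    rewrite DQ derivM deriv_exp hornerD !hornerM hornerMn hornerM !horner_exp.
    by rewrite hornerXsubC subrr !expr0n /= !(mulr0, mul0rn, addr0).
  have : D.[t] = D^`().[t] * (t - r) + 1.
    rewrite /D derivD derivC addr0 deriv_exp derivXsubC mul1r hornerMn.
    rewrite hornerD hornerC !horner_exp hornerXsubC.
    have -> : ((t - r) ^+ u.-1 *+ u = (t - r) ^+ u.-1).
      rewrite -[RHS]mulr1n -[u in _ *+ u]odd_double_half u_odd mulrnDr.
      by rewrite -muln2 mulnC mulrnA mulr2n (addrr_pchar2 F4_pchar2) mul0rn addr0.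
    by rewrite -exprSr prednK //; case: (u) u_odd.
  by rewrite Dt D't mul0r add0r => /eqP; rewrite eq_sym oner_eq0.
have : (size D <= 5)%N.
  have -> : 5%N = size (lin_prod (fun _ : F => 1%N)).
    rewrite /lin_prod; under eq_bigr do rewrite expr1.
    by rewrite size_prod_XsubC -[index_enum F]enumT -cardE hF.
  rewrite dvdp_leq ?lin_prod_neq0 // (dvdp_lin_prod Dm DS) lin_prod_dvd.
  exact/forallP.
by rewrite sD; case: (u) u_odd => [|[|[|[|[|]]]]].
Qed.

(** Write N = u 2^i with u odd; then Y^N + 1 = (Y^u + 1)^(2^i). *)
Lemma XsubCX_add1_split_pow2 e r N : (0 < N)%N ->
  ('X - r%:P) ^+ N + 1 %| lin_prod e ->
  exists i, N = (2 ^ i)%N \/ N = (3 * 2 ^ i)%N.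
Proof.
case/(@pfactor_coprime 2) => // u; rewrite coprime2n => u_odd NE.
rewrite NE exprM -exprD1_pow2 ?polyF4_pchar2 // => D_dvd.
have : ('X - r%:P) ^+ u + 1 %| lin_prod e.
  by apply: dvdp_trans D_dvd; rewrite -[X in X %| _]expr1 dvdp_exp2l // expn_gt0.
case/(XsubCX_add1_split u_odd)/orP => /eqP ->; exists (logn 2 N); last by right.
by left; rewrite mul1n.
Qed.

Lemma bu_sum_split_exps e r n :
  bu_sum n ('X - r%:P) %| lin_prod e -> exists E G, bu_exps n E G.
Proof.
move=> n_dvd; have sub1 (p : {poly F}) : p - 1 = p + 1.
  by rewrite (oppr_pchar2 polyF4_pchar2).
have [->|n_gt0] := posnP n; first by exists 0%N, 0%N; constructor 1.
(* Multiplying by Y + 1 = X - (r + 1), as the closed forms require, raises the exponent at [r + 1]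
   by one. *)
pose e' s := ((if s == (r + 1)%R then 1 else 0) + e s)%N.
have dvd' : ('X - r%:P - 1) * bu_sum n ('X - r%:P) %| lin_prod e'.
  by rewrite lin_prodD lin_prod_delta dvdp_mul // polyCD opprD addrA expr1.
have [n_odd|n_even] := boolP (odd n).
  move: dvd'; rewrite bu_sum_odd // sub1 => /XsubCX_add1_split_pow2[] // [|i].
    by rewrite expn0; lia.
  case=> nE; first by exists n, 0%N; constructor 2; exists i.
  exists (2 ^ i.+1).-1, (2 ^ i.+1)%N; constructor 3; exists i; split=> //.
  by rewrite prednK // expn_gt0.
have nE : n = n./2.*2 by rewrite even_halfK.
have m_gt0 : (0 < n./2)%N by lia.
move: dvd'; rewrite nE bu_sum_even // sub1 => dvd'.
have [i iE] :=
  XsubCX_add1_split_pow2 m_gt0 (dvdp_trans (dvdp_mull _ (dvdpp _)) dvd').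
have [//|j jE] :=
  XsubCX_add1_split_pow2 _ (dvdp_trans (dvdp_mulr _ (dvdpp _)) dvd').
(* [n./2] and its successor are both of the form 2^i or 3 * 2^i, and the odd one of them must be 1
   or 3. *)
have : n./2 \in [:: 1; 2; 3]%N.
  rewrite !inE; case: i j iE jE => [|i] [|j]; rewrite ?expnS; lia.
rewrite !inE => /or3P[]/eqP->; [exists 2%N, 0%N|exists 2%N, 1%N|exists 4%N, 1%N];
  by constructor 1.
Qed.

(** * Perfection and decomposability over F_4 *)

Lemma perfect_lin_prodP e (E G : F -> nat) :
  (forall r, bu_exps (e r) (E r) (G r)) ->
  biunitary_perfect (lin_prod e) <->
  forall s, e s = (E (s + 1)%R + (G (s + alpha)%R + G (s + alpha + 1)%R))%N.
Proof.
move=> exps; rewrite biunitary_perfect_lin_prod.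
have shift t (k : F -> nat) :
    \prod_r ('X - (r + t)%:P) ^+ k r = lin_prod (fun s => k (s + t)).
  rewrite [RHS](reindex_inj (addIr t)); apply: eq_bigr => r _.
  by rewrite -addrA (addrr_pchar2 F4_pchar2) addr0.
(* For Y = X - r, Y^2 + Y + 1 is (X - (r + alpha)) (X - (r + alpha + 1)). As t = -t, the factor X -
   s arises from r = s + t with t = 1, alpha, alpha + 1. *)
have -> : \prod_r bu_sum (e r) ('X - r%:P) =
    lin_prod (fun s => E (s + 1)%R + (G (s + alpha)%R + G (s + alpha + 1)%R))%N.
  rewrite !lin_prodD -(shift 1) -(shift alpha).
  under [X in _ * (_ * X)]eq_lin_prod do rewrite -addrA.
  rewrite -(shift (alpha + 1)) -!big_split; apply: eq_bigr => r _ /=.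
  rewrite (bu_sum_exps polyF4_pchar2 _ (exps r)); last first.
    by rewrite XsubC_add1 polyXsubC_eq0.
  rewrite XsubC_add1 -exprMn; congr (_ * _ ^+ _).
  have A0 : alpha%:P ^+ 2 + alpha%:P + 1 = 0 :> {poly F}.
    by rewrite -polyC_exp -!polyCD halpha.
  have two0 : 2%:R = 0 :> {poly F} by rewrite pcharf0 ?polyF4_pchar2.
  (* The multiples of alpha^2 + alpha + 1 and of 2 are explicit, so that what is left is an identity
     over the integers. *)
  transitivity (('X - r%:P) ^+ 2 + ('X - r%:P) + 1
    + (alpha%:P ^+ 2 + alpha%:P + 1)
    - 2%:R * (alpha%:P * ('X - r%:P) + ('X - r%:P) + 1)).
    by rewrite A0 two0 mul0r subr0 addr0.
  by rewrite !polyCD; ring.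
split=> [/eqP eE s|eE]; last by apply/eqP/eq_lin_prod => s; rewrite eE.
by rewrite -(mup_lin_prod e) -eE mup_lin_prod.
Qed.

(** [s - r] is nonzero, hence a root of Y + 1 or of Y^2 + Y + 1, and both occur in the
    factorization. *)
Lemma bu_sum_root n E G r s :
  bu_exps n E G -> (0 < E)%N -> (0 < G)%N -> s != r ->
  root (bu_sum n ('X - r%:P)) s.
Proof.
move=> exps E_gt0 G_gt0 sr.
have X1 : 'X - r%:P + 1 != 0 :> {poly F}.
  by rewrite XsubC_add1 polyXsubC_eq0.
rewrite (bu_sum_exps polyF4_pchar2 X1 exps).
move: {X1}('X - _) (hornerXsubC r s) => Y Ys.
rewrite /root hornerM !horner_exp !hornerD horner_exp hornerC Ys.
rewrite mulf_eq0 !expf_eq0 E_gt0 G_gt0 /=.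
have := F4_cases (s - r); rewrite !inE subr_eq0 (negbTE sr) /= => /or3P[] /eqP->.
- by rewrite (addrr_pchar2 F4_pchar2) eqxx.
- by rewrite halpha eqxx orbT.
- apply/orP; right; apply/eqP.
  transitivity ((alpha ^+ 2 + alpha + 1) + 2%:R * (alpha + 1)); first by ring.
  by rewrite halpha (pcharf0 F4_pchar2) mul0r addr0.
Qed.

(** The factor vanishing at [r] has the full multiplicity [e r] there, by coprimality. Being
    perfect, it is divisible by [bu_sum (e r) ('X - r%:P)], so it vanishes on all of [F]; a second
    factor also has a root, against coprimality. *)
Lemma lin_prod_indecomposable e E G r :
  bu_exps (e r) E G -> (0 < E)%N -> (0 < G)%N ->
  ~ trivially_biunitary_perfect (lin_prod e).
Proof.
move=> exps E_gt0 G_gt0 [_ [n [A_ [n_gt0 SA Aperf Acop]]]].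
have Asplit i : A_ i = lin_prod (fun s => mup s (A_ i)).
  apply: (@dvdp_lin_prod _ e); last by rewrite SA (bigD1 i) //= dvdp_mulr.
  by case/andP: (Aperf i) => _ /andP[].
have Aroot i : exists s, root (A_ i) s.
  have [s rs|noroot] := pickP (root (A_ i)); first by exists s.
  case/andP: (Aperf i); rewrite Asplit /lin_prod big1 ?size_poly1 // => s _.
  by rewrite mupNroot ?expr0 // noroot.
have er_gt0 : (0 < e r)%N by rewrite (bu_exps_degree exps); lia.
have [i ri] : exists i, root (A_ i) r.
  apply/existsP; apply: contraLR er_gt0 => /existsPn noroot.
  rewrite -(mup_lin_prod e) mupNroot // SA; apply: (big_ind (fun S => ~~ root S r)).
  - exact: root1.
  - by move=> S T; rewrite rootM negb_or => -> ->.
  - by move=> j _; apply: noroot.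
have mup_r : mup r (A_ i) = e r.
  rewrite -[RHS](mup_lin_prod e) SA (bigD1 i) //= mupMl //.
  apply: (big_ind (fun S => ~~ root S r)) => [|S T|j ji].
  - exact: root1.
  - by rewrite rootM negb_or => -> ->.
  - by apply: (coprimep_root (Acop _ _ _) ri); rewrite eq_sym.
have all_roots s : root (A_ i) s.
  have [-> //|sr] := eqVneq s r.
  case/andP: (Aperf i) => _; rewrite Asplit => /(bu_sum_dvd_perfect r).
  by rewrite mup_r => /root_dvdp; apply; apply: bu_sum_root exps _ _ sr.
have [j ji] : exists j : 'I_n.+1, j != i.
  have [i0|i0] := eqVneq i ord0; [exists ord_max|exists ord0].
    by rewrite i0 -(inj_eq val_inj) /= -lt0n.
  by rewrite eq_sym.
have [s rs] := Aroot j; have := coprimep_root (Acop _ _ ji) rs.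
by rewrite -/(root _ _) all_roots.
Qed.

(** The equations reduce to [e (s + 1) = e s]. They persist when [e] is restricted to {0, 1} or to
    its complement, both stable under adding 1. *)
Lemma lin_prod_trivially_perfect e :
  biunitary_perfect (lin_prod e) -> (forall s, 0 < e s)%N ->
  (forall s, bu_exps (e s) (e s) 0) -> trivially_biunitary_perfect (lin_prod e).
Proof.
move=> perf e_gt0 exps; split=> //.
have e1 s : e (s + 1) = e s.
  by have /(_ s) := (perfect_lin_prodP exps).1 perf; rewrite !addn0.
pose P (i : 'I_2) s := ((s == 0) || (s == 1)) == (i == ord0).
pose f i s := if P i s then e s else 0%N.
have P1 i s : P i (s + 1) = P i s.
  rewrite /P addr_eq0 (oppr_pchar2 F4_pchar2) orbC.
  by rewrite -[X in _ + 1 == X]add0r (inj_eq (addIr 1)).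
have fexps i s : bu_exps (f i s) (f i s) 0.
  by rewrite /f; case: ifP => // _; constructor 1.
have f_root i s : root (lin_prod (f i)) s = P i s.
  rewrite -dvdp_XsubCl XsubC_dvd ?lin_prod_neq0 // mup_lin_prod /f.
  by case: ifP; rewrite ?e_gt0.
exists 1%N, (fun i => lin_prod (f i)); split=> //.
- rewrite !big_ord_recl big_ord0 mulr1 -lin_prodD; apply: eq_lin_prod => s.
  by rewrite /f /P /=; case: (_ || _); rewrite ?addn0.
- move=> i; apply/andP; split.
    have [s Ps] : exists s, P i s.
      rewrite /P; case: (i == ord0); [by exists 0; rewrite eqxx|exists alpha].
      by case/and3P: F4_uniq; rewrite !inE !negb_or !(eq_sym alpha)
         => /and3P[_ /negbTE-> _] /andP[/negbTE-> _].
    apply: (@root_size_gt1 _ s); first exact: lin_prod_neq0.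
    by rewrite f_root.
  apply/(perfect_lin_prodP (fexps i)) => s.
  by rewrite !addn0 /f P1 e1.
- move=> i j ij; apply: coprimep_lin_prod => s; rewrite f_root /f.
  case: ifP => // /eqP Pj _; apply: contra ij => /eqP; rewrite Pj.
  rewrite -!(inj_eq val_inj) /=; case: i j {Pj} => i i2 [j j2] /=; lia.
Qed.

Lemma F4_bigprod (e : F -> nat) :
  lin_prod e = 'X ^+ e 0 * ('X + 1) ^+ e 1 * ('X + alpha%:P) ^+ e alpha
    * ('X + (alpha + 1)%:P) ^+ e (alpha + 1).
Proof.
have XaddC s : 'X - s%:P = 'X + s%:P.
  by rewrite -polyCN (oppr_pchar2 F4_pchar2).
rewrite /lin_prod (perm_big _ F4_enum) /= !big_cons big_nil !XaddC.
by rewrite addr0 mulr1 !mulrA.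
Qed.

End F4.

(** * Classification of the exponents *)

Theorem theorem3p2 (F : finFieldType) (hF : #|F| = 4%N)
    (alpha : F) (halpha : alpha ^+ 2 + alpha + 1 = 0)
    (a b c d : nat)
    (hpos : [&& (0 < a)%N, (0 < b)%N, (0 < c)%N & (0 < d)%N])
    (hodd : ~~ [&& odd a, odd b, odd c & odd d]) :
  indecomposable_biunitary_perfect
    ('X ^+ a * ('X + 1) ^+ b * ('X + alpha%:P) ^+ c
       * ('X + (alpha + 1)%:P) ^+ d)
  <->
  has (fun q : nat * nat * nat * nat =>
         q \in [:: (4, 4, 3, 5); (4, 4, 5, 3); (6, 6, 3, 5); (6, 6, 5, 3);
                   (4, 3, 4, 3); (4, 5, 4, 5); (4, 3, 3, 4); (4, 5, 5, 4);
                   (4, 4, 4, 4); (4, 4, 6, 6); (6, 6, 4, 4); (6, 6, 6, 6)]%N)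
      (translates a b c d).
Proof.
pose e (s : F) := if s == 0 then a else if s == 1 then b
            else if s == alpha then c else d.
have [/and3P[n01 n0a n0a1] /and3P[n1a n1a1 naa1]] :
    [&& 0 != 1 :> F, 0 != alpha & 0 != alpha + 1] /\
    [&& 1 != alpha, 1 != alpha + 1 & alpha != alpha + 1].
  move: (F4_uniq hF halpha); rewrite /= !inE !negb_or andbT -!andbA.
  by case/and4P=> -> -> -> /and3P[-> -> ->].
have e0 : e 0 = a by rewrite /e eqxx.
have e1 : e 1 = b by rewrite /e eq_sym (negbTE n01) eqxx.
have ea : e alpha = c by rewrite /e !(eq_sym alpha) (negbTE n0a) (negbTE n1a) eqxx.
have ea1 : e (alpha + 1) = d.
  by rewrite /e !(eq_sym (alpha + 1)) (negbTE n0a1) (negbTE n1a1) (negbTE naa1).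
have := F4_bigprod hF halpha e; rewrite e0 e1 ea ea1 => <-.
have aa : alpha + alpha = 0 := addrr_pchar2 (F4_pchar2 hF) alpha.
have oo : 1 + 1 = 0 :> F := addrr_pchar2 (F4_pchar2 hF) 1.
have addN s : (s + alpha + alpha = s) * (s + 1 + 1 = s).
  by rewrite -!addrA aa oo !addr0.
have system (E G : F -> nat) : (forall r, bu_exps (e r) (E r) (G r)) ->
    biunitary_perfect (lin_prod e) <->
    [/\ a = (E 1%R + G alpha + G (alpha + 1)%R)%N,
        b = (E 0%R + G alpha + G (alpha + 1)%R)%N,
        c = (E (alpha + 1)%R + G 0%R + G 1%R)%N &
        d = (E alpha + G 0%R + G 1%R)%N].
  move=> exps; apply: iff_trans (perfect_lin_prodP hF halpha exps) _; split.
    move=> eE; rewrite -{1}e0 -{1}e1 -{1}ea -{1}ea1 !eE !add0r oo aa.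
    rewrite addrAC oo add0r (addrC 1 alpha) !addN !add0r.
    rewrite [alpha + 1 + alpha]addrAC aa add0r oo.
    by split; ring.
  case=> eqa eqb eqc eqd s.
  have := F4_cases hF halpha s; rewrite !inE => /or4P[]/eqP->.
  - by rewrite e0 !add0r eqa; ring.
  - by rewrite e1 oo (addrC 1 alpha) !addN eqb; ring.
  - by rewrite ea aa add0r eqc; ring.
  - by rewrite ea1 !addN [alpha + 1 + alpha]addrAC aa add0r oo eqd; ring.
split.
  case=> perf indec.
  have split_exps r : exists E G, bu_exps (e r) E G.
    exact: (bu_sum_split_exps hF (bu_sum_dvd_perfect r perf)).
  have [E /fin_all_exists[G EG]] := fin_all_exists split_exps.
  have [eqa eqb eqc eqd] := (system E G EG).1 perf.
  move: (EG 0) (EG 1) (EG alpha) (EG (alpha + 1)).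
  rewrite e0 e1 ea ea1 => E0 E1 Ea Ea1.
  apply: (bu_exps_system hpos hodd E0 E1 Ea Ea1) => //.
  (* If every G vanished, the polynomial would be trivially perfect. *)
  rewrite lt0n !addn_eq0 -!andbA; apply/negP.
  case/and4P=> /eqP G0 /eqP G1 /eqP Ga /eqP Ga1.
  apply: indec.
  apply: (lin_prod_trivially_perfect hF halpha perf) => s.
    have := F4_cases hF halpha s; rewrite !inE => /or4P[]/eqP->;
    by rewrite ?e0 ?e1 ?ea ?ea1; lia.
  have Gs : G s = 0%N.
    by have := F4_cases hF halpha s; rewrite !inE => /or4P[]/eqP->.
  have := bu_exps_degree (EG s); rewrite Gs addn0 => eE.
  by have := EG s; rewrite Gs -eE.
move=> sol.
case/and5P: (solutions_system sol) => small f_gt0 /eqP eqa /eqP eqb.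
case/andP=> /eqP eqc /eqP eqd.
have exps r : bu_exps (e r) (exps_of (e r)).1 (exps_of (e r)).2.
  apply: exps_ofP; move: small; rewrite /=.
  have := F4_cases hF halpha r; rewrite !inE => /or4P[]/eqP->;
  by rewrite ?e0 ?e1 ?ea ?ea1; lia.
split; first by apply/(system _ _ exps); rewrite e0 e1 ea ea1.
(* For exponents from 3 to 6 the first entry of [exps_of] is positive, so one exponent with positive
   second entry prevents any decomposition. *)
have indec s : (2 < e s < 7)%N -> (0 < (exps_of (e s)).2)%N ->
    ~ trivially_biunitary_perfect (lin_prod e).
  move=> es; apply: (lin_prod_indecomposable hF halpha (exps s)).
  by case: (e s) es => [|[|[|[|[|[|[|]]]]]]].
move: small f_gt0 (indec 0) (indec 1) (indec alpha) (indec (alpha + 1)).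
rewrite /= e0 e1 ea ea1 !andbT orbF => /and4P[sa sb sc sd] /or4P[] fgt0 i0 i1 ia ia1.
- exact: i0.
- exact: i1.
- exact: ia.
- exact: ia1.
Qed.
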